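(* For each $a\in\{0,1,2\}$, the stable defect set $\mathscr{D}^a_{st}$ is well-ordered, of order type $\omega^\omega$. Furthermore, for every nonnegative integer $k$ with $k\equiv a\pmod 3$, the set $\mathscr{D}^a_{st}\cap[0,k]$ has order type $\omega^k$.
   Context: $\|n\|$ is the complexity of a positive integer $n$: the least number of $1$'s needed to write $n$ using $1$, $+$, $\times$ and parentheses; $\delta(n)=\|n\|-3\log_3 n$ is its defect. A positive integer $m$ is stable if $\|3^km\|=3k+\|m\|$ for all $k\ge1$. $\mathscr{D}_{st}$ is the set of defects $\delta(m)$ of stable numbers $m$. For a congruence class $a$ mod $3$, $\mathscr{D}^a=\{\delta(n):\|n\|\equiv a\pmod 3,\ n\ne1\}$ and $\mathscr{D}^a_{st}=\mathscr{D}^a\cap\mathscr{D}_{st}$. These are subsets of $\mathbb{R}$ with the usual order. *)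

(* Defs.v *)
From HB Require Import structures.
From mathcomp Require Import all_boot all_order all_algebra.
From mathcomp Require Import all_classical.
From mathcomp Require Import reals exp.

Set Implicit Arguments.
Unset Strict Implicit.
Unset Printing Implicit Defensive.

Import Order.TTheory GRing.Theory Num.Theory.
Local Open Scope classical_set_scope.

Inductive expr : Type :=
  | One
  | Add of expr & expr
  | Mul of expr & expr.

Fixpoint eval (e : expr) : nat :=
  match e with
  | One => 1
  | Add e1 e2 => eval e1 + eval e2
  | Mul e1 e2 => eval e1 * eval e2
  end.

Fixpoint ones (e : expr) : nat :=
  match e with
  | One => 1
  | Add e1 e2 | Mul e1 e2 => ones e1 + ones e2
  end.

Definition writable (n k : nat) : Prop := exists e, eval e = n /\ ones e = k.

(* Only [n = 0] is not writable, see [exists_writable]; [0] is a dummy value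
   there. *)
Definition complexity (n : nat) : nat :=
  match pselect (exists k, `[< writable n k >]) with
  | left h => ex_minn h
  | right _ => 0
  end.

Lemma exists_writable (n : nat) : 0 < n -> exists k, `[< writable n k >].
Proof.
case: n => // n _; elim: n => [|n [k /asboolP [e [en ek]]]].
  by exists 1; apply/asboolP; exists One.
exists k.+1; apply/asboolP; exists (Add One e).
by rewrite /= en ek.
Qed.

Lemma complexityP (n : nat) : 0 < n ->
  writable n (complexity n) /\
  forall k, writable n k -> complexity n <= k.
Proof.
move=> n0; rewrite /complexity; case: pselect => [h|[]]; last first.
  exact: exists_writable.
case: ex_minnP => m /asboolP wm min_m; split=> // k wk.
by apply: min_m; apply/asboolP.
Qed.

Definition stable (m : nat) : Prop :=
  0 < m /\
  forall k, 1 <= k -> complexity (3 ^ k * m) = 3 * k + complexity m.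

Local Open Scope ring_scope.

Section defects.
Variable R : realType.

Definition defect (n : nat) : R :=
  (complexity n)%:R - 3 * (ln n%:R / ln 3).

Definition Dst : set R := defect @` [set m | stable m].

Definition Dmod (a : nat) : set R :=
  defect @` [set n | [/\ (0 < n)%N, n <> 1%N & complexity n = a %[mod 3]]].

Definition Dmod_st (a : nat) : set R := Dmod a `&` Dst.

End defects.

Arguments Dst R : clear implicits.
Arguments Dmod R a : clear implicits.
Arguments Dmod_st R a : clear implicits.

Definition order_isomorphic (T U : Type) (ltT : T -> T -> Prop)
    (ltU : U -> U -> Prop) (A : set T) (B : set U) : Prop :=
  exists f : T -> U, set_bij A B f /\
    forall x y, A x -> A y -> (ltT x y <-> ltU (f x) (f y)).

(* The ordinal power omega ^ I, for a well-ordered exponent I: finitely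
   supported functions I -> nat, compared at the largest index at which they
   differ.  The exponent k is ['I_k] and the exponent omega is [nat]. *)
Section omega_power.
Context (d : Order.disp_t) (I : orderType d).

Definition omega_pow : set (I -> nat) :=
  [set f | finite_set [set i | f i <> 0%N]].

Definition omega_pow_lt (f g : I -> nat) : Prop :=
  exists i, (f i < g i)%N /\ forall j, (i < j)%O -> f j = g j.

End omega_power.

Definition has_order_type_omega_pow (R : realType) (A : set R)
    (d : Order.disp_t) (I : orderType d) : Prop :=
  order_isomorphic (@omega_pow_lt d I) (fun x y : R => x < y)
    (@omega_pow d I) A.

(* Main.v *)
Require Import Defs.
From HB Require Import structures.
From mathcomp Require Import all_boot all_order all_algebra.
From mathcomp Require Import all_classical.
From mathcomp Require Import wochoice.
From mathcomp Require Import reals exp.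
From mathcomp Require Import ring lra zify.

Set Implicit Arguments.
Unset Strict Implicit.
Unset Printing Implicit Defensive.

Import Order.TTheory GRing.Theory Num.Theory.
Local Open Scope classical_set_scope.
Local Open Scope ring_scope.

(** Call a set of reals small of rank k if its order type is less than omega ^ k.
The defects below s < k form a small set of rank k, by induction on k.  A number
whose shortest expression is a sum a + b has defect
d(a) + |b| - 3 log_3 (1 + b / a); here b is bounded, and when a is large
d(a) is at most about s - 1, so the induction hypothesis applies to d(a), while
the choice of a among the numbers of a given defect raises the rank by one.
Every other number greater than 1 is a product of such sums and its defect is
the sum of theirs; the positive ones among those are bounded away from 0, so
boundedly many occur, and ranks add under sums of sets of reals.

Conversely, the numbers written in base 3 as 10 followed by k further digits 1,
separated by arbitrary runs of zeros, have complexity at most 3h + 3 + k, where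
h is the number of digits following the leading 10, and modulo powers of 3 they
form a family of type omega ^ k.  Those for which the bound is not attained,
even after multiplication by powers of 3, have stable defects less than k - 1
and are too few by the upper bound, so the others already give stable defects of
type omega ^ k in [0, k], all with complexity congruent to k.  Comparing
well-orders turns the two bounds into an isomorphism. *)

(** * Sets of order type less than omega ^ k *)

Section SmallSets.
Context {T : Type} (lt : T -> T -> Prop).
Implicit Types (S A B C X : set T).

Inductive finite_cover (Q : set T -> Prop) : set T -> Prop :=
  | Cover1 A : Q A -> finite_cover Q A
  | CoverU A B S : S `<=` A `|` B ->
      finite_cover Q A -> finite_cover Q B -> finite_cover Q S.

(* For a well-ordered [S], [small k S] says that the order type of [S] is less
   than omega ^ k and [small_segments k S] that it is at most omega ^ k.  The
   pieces of a cover may be interleaved, so that closure under finite unions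
   needs no ordinal arithmetic. *)
Fixpoint small (k : nat) : set T -> Prop :=
  match k with
  | 0 => fun S => S `<=` set0
  | k.+1 => finite_cover (fun A => forall t, A t -> small k (A `&` [set x | lt x t]))
  end.

Definition small_segments k A : Prop :=
  forall t, A t -> small k (A `&` [set x | lt x t]).

Lemma smallU k A B S : S `<=` A `|` B -> small k A -> small k B -> small k S.
Proof.
case: k => [SAB A0 B0 x /SAB[/A0|/B0]//|k SAB sA sB]; exact: CoverU sA sB.
Qed.

Lemma small_sub k A S : S `<=` A -> small k A -> small k S.
Proof. by move=> SA sA; apply: (smallU _ sA sA) => x /SA; left. Qed.

Lemma small_empty k S : S `<=` set0 -> small k S.
Proof. by case: k => // k S0; apply: Cover1 => t /S0. Qed.

Lemma small_segments_small k A : small_segments k A -> small k.+1 A.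
Proof. exact: Cover1. Qed.

Lemma smallS k S : small k S -> small k.+1 S.
Proof.
elim: k S => [|k IHk] S; first exact: small_empty.
elim=> [A QA|A B {}S SAB _ sA _ sB]; last exact: CoverU SAB sA sB.
by apply: Cover1 => t /QA /IHk.
Qed.

Lemma small_leq k l S : (k <= l)%N -> small k S -> small l S.
Proof.
move=> /subnKC <-; elim: (l - k)%N => [|m IHm]; first by rewrite addn0.
by move=> /IHm; rewrite addnS; apply: smallS.
Qed.

Lemma small_bigU k n (F : nat -> set T) S :
  (forall x, S x -> exists2 i, (i < n)%N & F i x) ->
  (forall i, (i < n)%N -> small k (F i)) -> small k S.
Proof.
elim: n S => [|n IHn] S SF sF.
  by apply: small_empty => x /SF[].
apply: (@smallU k (F n) (S `&` [set x | exists2 i, (i < n)%N & F i x])).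
- move=> x Sx; have [i] := SF x Sx.
  rewrite ltnS leq_eqVlt => /predU1P[-> Fx|lt_in Fx]; first by left.
  by right; split=> //; exists i.
- exact: sF.
- by apply: IHn => [x []//|i lt_in]; apply/sF/leqW.
Qed.

Lemma small_image_nat (irr : forall x, ~ lt x x) k n (F : nat -> T) :
  small k.+1 [set x | exists2 i, (i < n)%N & F i = x].
Proof.
apply: (@small_leq 1) => //; apply: (@small_bigU _ n (fun i => [set F i])).
  by move=> x /= [i ? <-]; exists i.
by move=> i _; apply: Cover1 => t /= -> x [/= ->] /irr.
Qed.

(** Induction on the rank, then on the cover. In a single piece, an element of [X] is either minimal
    or has a part of smaller rank below it. In a union, take the minimum of [X] in one piece and
    then, if elements of [X] in the other piece lie below it, the minimum of those. *)
Lemma small_segments_wf (tr : forall x y z, lt x y -> lt y z -> lt x z) A :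
  (forall t, A t -> exists k, small k (A `&` [set x | lt x t])) ->
  forall X, X `<=` A -> X !=set0 ->
  exists x, X x /\ forall y, X y -> ~ lt y x.
Proof.
move=> Asmall.
have wf k : forall S, small k S -> forall X, X `<=` S -> X !=set0 ->
    exists x, X x /\ forall y, X y -> ~ lt y x.
  elim: k => [S S0 X XS [x /XS /S0]//|k IHk S].
  elim=> {S} [S QS X XS [t Xt]|B C S SBC _ IHB _ IHC X XS [t Xt]].
    have [[x [Xx lt_xt]]|noX] := pselect ((X `&` [set x | lt x t]) !=set0).
      have [||m [[Xm lt_mt] minm]] :=
        IHk _ (QS t (XS _ Xt)) (X `&` [set x | lt x t]).
      - by move=> y [/XS].
      - by exists x.
      exists m; split=> // y Xy lt_ym; apply: (minm y) => //; split=> //.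
      exact: tr lt_mt.
    by exists t; split=> // y Xy lt_yt; apply: noX; exists y.
  have [nB|noB] := pselect ((X `&` B) !=set0); last first.
    apply: IHC; last by exists t.
    by move=> y Xy; have [By|//] := SBC _ (XS _ Xy); case: noB; exists y.
  have [|m [[Xm _] minm]] := IHB (X `&` B) _ nB; first by move=> ? [].
  have [nC|noC] := pselect ((X `&` C `&` [set x | lt x m]) !=set0); last first.
    exists m; split=> // y Xy lt_ym; have [By|Cy] := SBC _ (XS _ Xy).
      exact: (minm y).
    by apply: noC; exists y.
  have [|l [[[Xl _] lt_lm] minl]] := IHC (X `&` C `&` [set x | lt x m]) _ nC.
    by move=> ? [[]].
  exists l; split=> // y Xy lt_yl; have lt_ym := tr _ _ _ lt_yl lt_lm.
  by have [By|Cy] := SBC _ (XS _ Xy); [exact: (minm y)|exact: (minl y)].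
move=> X XA [t Xt].
have [[x [Xx lt_xt]]|noX] := pselect ((X `&` [set x | lt x t]) !=set0).
  have [k sk] := Asmall t (XA _ Xt).
  have [||m [[Xm lt_mt] minm]] := wf k _ sk (X `&` [set x | lt x t]).
  - by move=> y [/XA].
  - by exists x.
  exists m; split=> // y Xy lt_ym; apply: (minm y) => //; split=> //.
  exact: tr lt_mt.
by exists t; split=> // y Xy lt_yt; apply: noX; exists y.
Qed.

(* A piece of the cover that meets the blocks [C j] infinitely often has each
   of its traces [C j `&` A] inside a proper initial segment; any other piece
   misses all but finitely many blocks. *)
Lemma not_small_consecutive k S (C : nat -> set T) :
  (forall j, C j `<=` S) ->
  (forall i j x y, (i < j)%N -> C i x -> C j y -> lt x y) ->
  (forall j, ~ small k (C j)) -> ~ small k.+1 S.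
Proof.
move=> CS Clt nC sS.
suff [J sJ] : exists J, forall j, (J <= j)%N -> small k (C j `&` S).
  by apply: (nC J); apply: small_sub (sJ J (leqnn _)) => x Cx; split=> //; apply: CS Cx.
elim: sS => {S CS} [A QA|A B S SAB _ [J sJ] _ [K sK]]; last first.
  exists (maxn J K) => j; rewrite geq_max => /andP[/sJ sA /sK sB].
  by apply: (smallU _ sA sB) => x [Cx /SAB[]]; [left|right].
have [[J noJ]|inf] := pselect (exists J, forall j, (J <= j)%N -> C j `&` A `<=` set0).
  by exists J => j /noJ; apply: small_empty.
exists 0%N => j _; apply: contrapT => nsj; apply: inf.
exists j.+1 => i lt_ji x [Cx Ax]; apply: nsj.
apply: small_sub (QA x Ax) => y [Cy Ay]; split=> //=; exact: Clt Cy Cx.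
Qed.

End SmallSets.

(** A cover of [B] pulls back along [h] piece by piece, and the part of a piece below [t] goes into
    the part below [h t]. *)
Lemma small_embedding (T U : Type) (ltT : T -> T -> Prop) (ltU : U -> U -> Prop)
    (h : T -> U) k (A : set T) (B : set U) :
  A `<=` h @^-1` B ->
  (forall x y, A x -> A y -> ltT x y -> ltU (h x) (h y)) ->
  small ltU k B -> small ltT k A.
Proof.
elim: k A B => [A B AB _ B0 x /AB /B0//|k IHk A B AB hlt sB].
elim: sB A AB hlt => {B} [B QB A AB hlt|B C D DBC _ IHB _ IHC A AD hlt].
  apply: Cover1 => t At; apply: IHk (QB (h t) (AB t At)).
    by move=> x [Ax lt_xt]; split=> /=; [exact: AB|exact: hlt].
  by move=> x y [Ax _] [Ay _]; apply: hlt.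
apply: (@CoverU _ _ (A `&` h @^-1` B) (A `&` h @^-1` C)).
- by move=> x Ax; have [] := DBC _ (AD _ Ax); [left|right].
- by apply: IHB => [x []//|x y [? _] [? _]]; apply: hlt.
- by apply: IHC => [x []//|x y [? _] [? _]]; apply: hlt.
Qed.

(** * Comparison of well-orders *)

Section Comparison.
Context {T U : Type} (ltT : T -> T -> Prop) (ltU : U -> U -> Prop).
Context (A : set T) (B : set U).

Definition well_ordered_by (V : Type) (lt : V -> V -> Prop) (D : set V) : Prop :=
  [/\ forall x, ~ lt x x,
      forall x y, D x -> D y -> [\/ lt x y, x = y | lt y x]
    & forall X, X `<=` D -> X !=set0 -> exists x, X x /\ forall y, X y -> ~ lt y x].

(* The initial segments of [A] below [x] and of [B] below [y] are isomorphic. *)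
Inductive same_rank : T -> U -> Prop :=
  | SameRank x y : A x -> B y ->
      (forall x', A x' -> ltT x' x -> exists2 y', ltU y' y & same_rank x' y') ->
      (forall y', B y' -> ltU y' y -> exists2 x', ltT x' x & same_rank x' y') ->
      same_rank x y.

Lemma same_rankE x y : same_rank x y -> [/\ A x, B y,
  forall x', A x' -> ltT x' x -> exists2 y', ltU y' y & same_rank x' y' &
  forall y', B y' -> ltU y' y -> exists2 x', ltT x' x & same_rank x' y'].
Proof. by case. Qed.

End Comparison.

Lemma well_ordered_by_sub (V : Type) (lt : V -> V -> Prop) (A B : set V) :
  A `<=` B -> well_ordered_by lt B -> well_ordered_by lt A.
Proof.
move=> AB [irr tot wf]; split=> //.
- by move=> x y /AB ? /AB ?; apply: tot.
- by move=> X XA; apply: wf => x /XA /AB.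
Qed.

Lemma same_rank_sym (T U : Type) (ltT : T -> T -> Prop) (ltU : U -> U -> Prop)
    (A : set T) (B : set U) :
  (forall X, X `<=` A -> X !=set0 -> exists x, X x /\ forall y, X y -> ~ ltT y x) ->
  forall x y, same_rank ltT ltU A B x y -> same_rank ltU ltT B A y x.
Proof.
move=> wf x y Mxy; apply: contrapT => nM.
pose X := [set x | exists2 y, same_rank ltT ltU A B x y & ~ same_rank ltU ltT B A y x].
have [||x0 [[y0 M0 nM0] min0]] := wf X; first by move=> z [w M _]; case: (same_rankE M).
  by exists x, y.
apply: nM0; have [Ax By hx hy] := same_rankE M0; apply: SameRank => //.
- move=> y' By' lt'; have [x' lt_x' M'] := hy _ By' lt'; exists x' => //.
  by apply: contrapT => n; apply: (min0 x') => //; exists y'.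
- move=> x' Ax' lt'; have [y' lt_y' M'] := hx _ Ax' lt'; exists y' => //.
  by apply: contrapT => n; apply: (min0 x') => //; exists y'.
Qed.

(** Take the least [x] with two partners, [y] below [z]. Then [y] is also the partner of some
    smaller [x'], which in turn has a further partner below [y], against minimality. *)
Lemma same_rank_fun (T U : Type) (ltT : T -> T -> Prop) (ltU : U -> U -> Prop)
    (A : set T) (B : set U) :
  well_ordered_by ltT A -> well_ordered_by ltU B ->
  forall x y z, same_rank ltT ltU A B x y -> same_rank ltT ltU A B x z -> y = z.
Proof.
move=> [irrA totA wfA] [irrB totB wfB] x y z Mxy Mxz; apply: contrapT => nyz.
pose X := [set x | exists y z,
  [/\ same_rank ltT ltU A B x y, same_rank ltT ltU A B x z & ltU y z]].
have [||x0 [[y0 [z0 [My Mz lt_yz]]] min0]] := wfA X.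
- by move=> w [y1 [z1 [M1 _ _]]]; case: (same_rankE M1).
- have [_ By _ _] := same_rankE Mxy; have [_ Bz _ _] := same_rankE Mxz.
  by exists x; have [?|//|?] := totB y z By Bz; [exists y, z|exists z, y].
have [_ By hy _] := same_rankE My; have [_ Bz _ hz] := same_rankE Mz.
have [x' lt_x' M'] := hz _ By lt_yz; have [Ax' _ _ _] := same_rankE M'.
have [y' lt_y' M''] := hy _ Ax' lt_x'.
by apply: (min0 x') => //; exists y', y0.
Qed.

(** The matching [M] is an order isomorphism between initial segments. If both sides had unmatched
    elements, the least ones would match each other; if only one side has some, [M] embeds the other
    side below one of them. *)
Lemma order_isomorphic_of_no_embedding (T U : Type)
    (ltT : T -> T -> Prop) (ltU : U -> U -> Prop) (t0 : T) (u0 : U)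
    (A : set T) (B : set U) :
  well_ordered_by ltT A -> well_ordered_by ltU B ->
  (forall (h : T -> U) y, B y -> A `<=` h @^-1` (B `&` [set z | ltU z y]) ->
     ~ (forall x x', A x -> A x' -> ltT x x' -> ltU (h x) (h x'))) ->
  (forall (h : U -> T) x, A x -> B `<=` h @^-1` (A `&` [set z | ltT z x]) ->
     ~ (forall y y', B y -> B y' -> ltU y y' -> ltT (h y) (h y'))) ->
  order_isomorphic ltT ltU A B.
Proof.
move=> woA woB; have [irrA totA wfA] := woA; have [irrB totB wfB] := woB.
move=> noAB noBA; set M := same_rank ltT ltU A B.
have funM x y z : M x y -> M x z -> y = z by exact: same_rank_fun.
have injM x y z : M x z -> M y z -> x = y.
  move=> Mxz Myz; apply: (same_rank_fun woB woA (x := z));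
  exact: same_rank_sym.
have MA x y : M x y -> A x by move=> Mxy; case: (same_rankE Mxy).
have MB x y : M x y -> B y by move=> Mxy; case: (same_rankE Mxy).
have monoM x y x' y' : M x y -> M x' y' -> ltT x x' -> ltU y y'.
  move=> Mxy Mxy' lt_x.
  have [_ _ /(_ x (MA _ _ Mxy) lt_x)[z lt_z Mz] _] := same_rankE Mxy'.
  by rewrite (funM _ _ _ Mxy Mz).
have monoM' x y x' y' : M x y -> M x' y' -> ltU y y' -> ltT x x'.
  move=> Mxy Mxy' lt_y.
  have [_ _ _ /(_ y (MB _ _ Mxy) lt_y)[z lt_z Mz]] := same_rankE Mxy'.
  by rewrite (injM _ _ _ Mxy Mz).
(* [u0] is the default value off the domain of [M], and [t0] plays the same part for [g]. *)
have [f fP] : exists f : T -> U, forall x, (exists y, M x y) -> M x (f x).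
  suff /choice[f fP] : forall x, exists y, (exists y, M x y) -> M x y by exists f.
  by move=> x; have [[y Mxy]|n] := pselect (exists y, M x y); [exists y|exists u0].
have [g gP] : exists g : U -> T, forall y, (exists x, M x y) -> M (g y) y.
  suff /choice[g gP] : forall y, exists x, (exists x, M x y) -> M x y by exists g.
  by move=> y; have [[x Mxy]|n] := pselect (exists x, M x y); [exists x|exists t0].
have domP x : A x -> ~ (exists y, M x y) ->
    exists2 x0, A x0 /\ ~ (exists y, M x0 y)
    & forall x', A x' -> ltT x' x0 -> exists y, M x' y.
  move=> Ax nx; have [||x0 [[Ax0 nx0] min0]] :=
    wfA (A `&` [set x | ~ exists y, M x y]); first by move=> ? [].
    by exists x.
  exists x0 => // x' Ax' lt_x'; apply: contrapT => n; exact: (min0 x').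
have ranP y : B y -> ~ (exists x, M x y) ->
    exists2 y0, B y0 /\ ~ (exists x, M x y0)
    & forall y', B y' -> ltU y' y0 -> exists x, M x y'.
  move=> By ny; have [||y0 [[By0 ny0] min0]] :=
    wfB (B `&` [set y | ~ exists x, M x y]); first by move=> ? [].
    by exists y.
  exists y0 => // y' By' lt_y'; apply: contrapT => n; exact: (min0 y').
have ltran x y y0 : M x y -> B y0 -> ~ (exists x, M x y0) -> ltU y y0.
  move=> Mxy By0 ny0; have [//|e|lt_y] := totB y y0 (MB _ _ Mxy) By0.
    by case: ny0; exists x; rewrite -e.
  have [_ _ _ /(_ _ By0 lt_y)[z _ Mz]] := same_rankE Mxy.
  by case: ny0; exists z.
have ltdom x y x0 : M x y -> A x0 -> ~ (exists y, M x0 y) -> ltT x x0.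
  move=> Mxy Ax0 nx0; have [//|e|lt_x] := totA x x0 (MA _ _ Mxy) Ax0.
    by case: nx0; exists y; rewrite -e.
  have [_ _ /(_ _ Ax0 lt_x)[z _ Mz] _] := same_rankE Mxy.
  by case: nx0; exists z.
have [domA|/existsNP[x /not_implyP[Ax nx]]] :=
    pselect (forall x, A x -> exists y, M x y).
  have [ranB|/existsNP[y /not_implyP[By ny]]] :=
      pselect (forall y, B y -> exists x, M x y).
    exists f; split; first split.
    - by move=> x /domA /fP /MB.
    - move=> x x'; rewrite !inE => /domA /fP Mx /domA /fP Mx' e.
      by apply: injM Mx _; rewrite e.
    - move=> y /ranB[x Mxy]; exists x; first exact: MA Mxy.
      by apply: (funM _ _ _ (fP x _) Mxy); exists y.
    - move=> x x' /domA /fP Mx /domA /fP Mx'.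
      by split; [apply: (monoM _ _ _ _ Mx Mx')|apply: (monoM' _ _ _ _ Mx Mx')].
  case: (noAB f y By).
    move=> x Ax; have Mx := fP _ (domA _ Ax); split=> /=; first exact: MB Mx.
    exact: ltran Mx By ny.
  move=> x x' /domA /fP Mx /domA /fP Mx'; exact: (monoM _ _ _ _ Mx Mx').
have [ranB|/existsNP[y /not_implyP[By ny]]] :=
    pselect (forall y, B y -> exists x, M x y).
  case: (noBA g x Ax).
    move=> y By; have My := gP _ (ranB _ By); split=> /=; first exact: MA My.
    exact: ltdom My Ax nx.
  move=> y y' /ranB /gP My /ranB /gP My'; exact: (monoM' _ _ _ _ My My').
have [x0 [Ax0 nx0] minx] := domP _ Ax nx.
have [y0 [By0 ny0] miny] := ranP _ By ny.
case: (nx0); exists y0; apply: SameRank => //.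
- move=> x' Ax' lt_x'; have [y' M'] := minx _ Ax' lt_x'.
  by exists y' => //; apply: ltran M' By0 ny0.
- move=> y' By' lt_y'; have [x' M'] := miny _ By' lt_y'.
  by exists x' => //; apply: ltdom M' Ax0 nx0.
Qed.

(** * The ordinals omega ^ k and omega ^ omega *)

Section OmegaPowers.
Local Open Scope nat_scope.
Implicit Types (f g h : nat -> nat) (k i : nat).

Local Notation flt := (@omega_pow_lt _ nat).

(** A copy of omega ^ k inside [nat -> nat], so that all these ordinals and omega ^ omega share one
    order. *)
Definition supported_below k : set (nat -> nat) :=
  [set f | forall i, k <= i -> f i = 0].

Lemma omega_pow_lt_irr (d : Order.disp_t) (I : orderType d) (f : I -> nat) :
  ~ omega_pow_lt f f.
Proof. by case=> i []; rewrite ltnn. Qed.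

Lemma omega_pow_lt_trans f g h : flt f g -> flt g h -> flt f h.
Proof.
move=> [i [fgi fgj]] [l [ghl ghj]]; case: (ltngtP i l) => [lt_il|lt_li|eil].
- exists l; split=> [|j lt_lj]; first by rewrite fgj.
  by rewrite fgj ?ghj // (lt_trans _ lt_lj).
- exists i; split=> [|j lt_ij]; first by rewrite -ghj.
  by rewrite fgj ?ghj // (lt_trans _ lt_ij).
- subst l; exists i; split=> [|j lt_ij]; first exact: ltn_trans ghl.
  by rewrite fgj ?ghj.
Qed.

Lemma omega_pow_lt_total f g k : (forall i, k <= i -> f i = g i) ->
  [\/ flt f g, f = g | flt g f].
Proof.
elim: k => [fg|k IHk fg]; first by constructor 2; apply/funext => i; apply: fg.
have [ltk|gtk|ek] := ltngtP (f k) (g k).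
- by constructor 1; exists k; split=> // j lt_kj; apply: fg.
- by constructor 3; exists k; split=> // j lt_kj; rewrite fg.
- by apply: IHk => i; rewrite leq_eqVlt => /predU1P[<-//|]; apply: fg.
Qed.

Lemma supported_below_leq k l : k <= l -> supported_below k `<=` supported_below l.
Proof. by move=> le_kl f fk i /(leq_trans le_kl); apply: fk. Qed.

Lemma omega_pow_natP f : omega_pow f <-> exists k, supported_below k f.
Proof.
split=> [/finite_seqP[s fs]|[k fk]]; last first.
  apply: (@sub_finite_set _ _ `I_k); last exact: finite_II.
  by move=> i /= fi; rewrite ltnNge; apply/negP => /fk.
exists (\max_(i <- s) i).+1 => i lt_i; apply: contrapT => fi.
have : [set i | f i <> 0] i by [].
rewrite fs /= => si; have := @leq_bigmax_seq _ s xpredT id i si isT.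
by rewrite leqNgt lt_i.
Qed.

Lemma supported_below_lt k f g :
  supported_below k g -> flt f g -> (forall i, k <= i -> f i = g i).
Proof.
move=> gk [i [fgi fgj]] j le_kj; apply: fgj.
rewrite ltEnat /= (leq_trans _ le_kj) // ltnNge; apply/negP => /gk gi.
by rewrite gi ltn0 in fgi.
Qed.

Definition set_coord k c f : nat -> nat := fun i => if i == k then c else f i.

Lemma supported_below_set_coord k c f :
  supported_below k f -> supported_below k.+1 (set_coord k c f).
Proof.
by move=> fk i lt_ki; rewrite /set_coord gtn_eqF //; apply/fk/ltnW.
Qed.

Lemma set_coord_lt k c f g : f k = g k -> flt f g ->
  flt (set_coord k c f) (set_coord k c g).
Proof.
move=> fgk [i [fgi fgj]]; exists i; rewrite /set_coord; split=> [|j lt_ij].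
  by case: eqP => // eik; rewrite eik fgk ltnn in fgi.
by case: eqP => // _; apply: fgj.
Qed.

Lemma small_segments_supported_below k : small_segments flt k (supported_below k).
Proof.
elim: k => [|k IHk] f Wf.
  move=> g [Wg [i [gfi _]]]; by rewrite Wf in gfi.
(* The elements below [f] fall into layers by their coordinate at [k], which is at most [f k]; each
   layer is a copy of omega ^ k. *)
apply: (@small_bigU _ _ _ (f k).+1
  (fun c => [set g | supported_below k.+1 g /\ g k = c])).
  move=> g [Wg [i [gfi gfj]]]; exists (g k) => //; rewrite ltnS.
  have le_ik : i <= k.
    by rewrite leqNgt; apply/negP => /Wf fi; rewrite fi ltn0 in gfi.
  by move: le_ik; rewrite leq_eqVlt => /predU1P[<-|/gfj->//]; apply: ltnW.
move=> c _; apply: (small_embedding (h := set_coord k 0) _ _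
  (small_segments_small IHk)) => [|g h [_ gk] [_ hk]].
  move=> g [Wg gk]; rewrite /= => i; rewrite leq_eqVlt /set_coord.
  by move=> /predU1P[<-|lt_ki]; [rewrite eqxx|rewrite gtn_eqF // Wg].
by apply: set_coord_lt; rewrite gk hk.
Qed.

Lemma not_small_supported_below k : ~ small flt k (supported_below k).
Proof.
elim: k => [/(_ (fun=> 0))|k IHk]; first by apply.
(* The layers with top coordinate [c] are consecutive copies of omega ^ k. *)
pose C c : set (nat -> nat) := [set g | supported_below k.+1 g /\ g k = c].
apply: (@not_small_consecutive _ _ _ _ C) => [j g []//|i j f g lt_ij|j sC].
  move=> [Wf fk] [Wg gk]; exists k; split=> [|l lt_kl]; first by rewrite fk gk.
  by rewrite Wf ?Wg.
apply: IHk; apply: (small_embedding (h := set_coord k j) _ _ sC) => [f fk|f g fk gk].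
  split=> /=; first exact: (@supported_below_set_coord k j).
  by rewrite /set_coord eqxx.
by apply: set_coord_lt; rewrite fk ?gk.
Qed.

Lemma well_ordered_omega_pow_nat : well_ordered_by flt (@omega_pow _ nat).
Proof.
split; first exact: omega_pow_lt_irr.
  move=> f g /omega_pow_natP[k fk] /omega_pow_natP[l gl].
  apply: (@omega_pow_lt_total _ _ (maxn k l)) => i.
  by rewrite geq_max => /andP[ki li]; rewrite fk ?gl.
apply: small_segments_wf; first exact: omega_pow_lt_trans.
move=> f /omega_pow_natP[k fk]; exists k.
apply: small_sub (small_segments_supported_below fk) => g [_ lt_gf]; split=> //.
by move=> i le_ki; rewrite (supported_below_lt fk lt_gf) ?fk.
Qed.

Lemma well_ordered_supported_below k : well_ordered_by flt (supported_below k).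
Proof.
apply: well_ordered_by_sub well_ordered_omega_pow_nat => f fk.
by apply/omega_pow_natP; exists k.
Qed.

(** Extension by 0 identifies functions on ['I_k] with [supported_below k]. *)
Lemma omega_pow_ord_isomorphic (U : Type) (ltU : U -> U -> Prop) (B : set U) k :
  order_isomorphic flt ltU (supported_below k) B ->
  order_isomorphic (@omega_pow_lt _ 'I_k) ltU (@omega_pow _ 'I_k) B.
Proof.
move=> [F [[Ffun Finj Fsurj] Fmono]].
pose ext (f : 'I_k -> nat) : nat -> nat := fun i => oapp f 0 (insub i).
have extE (f : 'I_k -> nat) (i : 'I_k) : ext f i = f i by rewrite /ext valK.
have extW (f : 'I_k -> nat) : supported_below k (ext f).
  by move=> i le_ki; rewrite /ext insubF // ltnNge le_ki.
have ext_lt (f g : 'I_k -> nat) : omega_pow_lt f g <-> flt (ext f) (ext g).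
  split=> [[i [fgi fgj]]|[i [fgi fgj]]].
    exists (val i); rewrite !extE; split=> // j lt_ij.
    have [lt_jk|le_kj] := ltnP j k; last by rewrite !extW.
    by have := fgj (Ordinal lt_jk) lt_ij; rewrite -(extE f) -(extE g).
  have lt_ik : i < k.
    by rewrite ltnNge; apply/negP => le_ki; rewrite (extW g) in fgi.
  exists (Ordinal lt_ik); rewrite -(extE f) -(extE g); split=> // j lt_ij.
  by rewrite -(extE f) -(extE g); apply: fgj.
exists (F \o ext); split; first split.
- by move=> f _; apply: Ffun.
- move=> f g _ _ /Finj; rewrite !inE => /(_ (extW f) (extW g)) e.
  by apply/funext => i; rewrite -(extE f) -(extE g) e.
- move=> u /Fsurj[g gk <-]; exists (fun i : 'I_k => g i).
    exact: finite_finset.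
  congr F; apply/funext => i; rewrite /ext; case: insubP => [j _ <-//|].
  by rewrite -leqNgt => /gk.
- by move=> f g _ _; rewrite ext_lt; apply: Fmono.
Qed.

End OmegaPowers.

(** * Integer complexity *)

Section Complexity.
Local Open Scope nat_scope.

Lemma eval_gt0 e : 0 < eval e.
Proof. by elim: e => //= e1 h1 e2 h2; rewrite ?muln_gt0 ?addn_gt0 ?h1 ?h2. Qed.

Lemma complexity_eval e : complexity (eval e) <= ones e.
Proof. by case: (complexityP (eval_gt0 e)) => _; apply; exists e. Qed.

Lemma complexity_min_expr n : 0 < n -> exists2 e, eval e = n & ones e = complexity n.
Proof. by move=> /complexityP[[e [? ?]] _]; exists e. Qed.

Lemma complexityD m n : 0 < m -> 0 < n ->
  complexity (m + n) <= complexity m + complexity n.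
Proof.
move=> /complexity_min_expr[e <- <-] /complexity_min_expr[f <- <-].
exact: (complexity_eval (Add e f)).
Qed.

Lemma complexityM m n : 0 < m -> 0 < n ->
  complexity (m * n) <= complexity m + complexity n.
Proof.
move=> /complexity_min_expr[e <- <-] /complexity_min_expr[f <- <-].
exact: (complexity_eval (Mul e f)).
Qed.

(** For summands above 1 the sum is at most the product, so only adding 1 needs care: the cube of a
    + 1 is at most 3 a ^ 3 once a >= 3, and a = 1, 2 are checked directly. *)
Lemma cube_eval_le e : eval e ^ 3 <= 3 ^ ones e.
Proof.
have ones_gt0 f : 0 < ones f by elim: f => //= f1 h1 f2 _; rewrite addn_gt0 h1.
have succ_bound a p : 0 < p -> 0 < a -> a ^ 3 <= 3 ^ p -> (a + 1) ^ 3 <= 3 ^ p.+1.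
  move=> p0 a0 ap; have [a3|a3] := leqP 3 a.
    rewrite [3 ^ p.+1]expnS (leq_trans _ (leq_mul (leqnn 3) ap)) //.
    by rewrite !(expnS _ 2) -!mulnn; nia.
  case: a a0 a3 ap => // -[|[|//]] _ _ ap.
    by apply: (@leq_trans (3 ^ 2)) => //; rewrite leq_pexp2l.
  case: p p0 ap => // -[//|p] _ _.
  by apply: (@leq_trans (3 ^ 3)) => //; rewrite leq_pexp2l.
elim: e => //= e1 IH1 e2 IH2; last by rewrite expnMn expnD leq_mul.
have [e1_gt1|] := ltnP 1 (eval e1); last first.
  move=> le1; have e1_1 : eval e1 = 1 by apply/eqP; rewrite eqn_leq le1 eval_gt0.
  rewrite e1_1 addnC (leq_trans (succ_bound _ _ (ones_gt0 e2) (eval_gt0 _) IH2)) //.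
  by rewrite leq_pexp2l // -add1n leq_add2r ones_gt0.
have [e2_gt1|le2] := ltnP 1 (eval e2); last first.
  have e2_1 : eval e2 = 1 by apply/eqP; rewrite eqn_leq le2 eval_gt0.
  rewrite e2_1 (leq_trans (succ_bound _ _ (ones_gt0 e1) (eval_gt0 _) IH1)) //.
  by rewrite leq_pexp2l // -addn1 leq_add2l ones_gt0.
rewrite expnD (leq_trans _ (leq_mul IH1 IH2)) // -expnMn leq_exp2r //.
nia.
Qed.

Lemma cube_le n : n ^ 3 <= 3 ^ complexity n.
Proof.
case: n => // n; have [e <- <-] := complexity_min_expr (ltn0Sn n).
exact: cube_eval_le.
Qed.

Lemma complexity_gt0 n : 0 < n -> 0 < complexity n.
Proof.
move=> n0; have [e _ <-] := complexity_min_expr n0.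
by elim: e => //= e1 h1 e2 _; rewrite addn_gt0 h1.
Qed.

Lemma complexity1 : complexity 1 = 1.
Proof. by apply/eqP; rewrite eqn_leq (complexity_eval One) complexity_gt0. Qed.

Lemma complexity3_le : complexity 3 <= 3.
Proof. exact: (complexity_eval (Add One (Add One One))). Qed.

Lemma complexity_pow3M k n : 0 < n -> complexity (3 ^ k * n) <= 3 * k + complexity n.
Proof.
move=> n0; elim: k => [|k IHk]; first by rewrite mul1n.
rewrite expnS -mulnA (leq_trans (complexityM _ _)) ?muln_gt0 ?expn_gt0 //.
have := complexity3_le; lia.
Qed.

(** The cases are the outermost operation of a shortest expression, whose operands must be shortest
    too. A factor 1 could be dropped, which would shorten the expression. *)
Lemma efficient_cases n : 0 < n ->
  [\/ n = 1,
      exists a b, [/\ 0 < b, b <= a, n = a + b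
                    & complexity n = complexity a + complexity b]
    | exists u v, [/\ 1 < u, 1 < v, n = u * v
                    & complexity n = complexity u + complexity v]].
Proof.
move=> n0; have [e en ce] := complexity_min_expr n0.
case: e en ce => [|e1 e2|e1 e2] /= en ce; first by constructor 1.
  constructor 2; have c1 := complexity_eval e1; have c2 := complexity_eval e2.
  have := complexityD (eval_gt0 e1) (eval_gt0 e2); rewrite en => cD.
  have [le21|lt12] := leqP (eval e2) (eval e1).
    by exists (eval e1), (eval e2); rewrite eval_gt0 en; split=> //; lia.
  by exists (eval e2), (eval e1); rewrite eval_gt0 addnC en; split=> //; lia.
constructor 3; have c1 := complexity_eval e1; have c2 := complexity_eval e2.
have cM := complexityM (eval_gt0 e1) (eval_gt0 e2).
have p1 := complexity_gt0 (eval_gt0 e1); have p2 := complexity_gt0 (eval_gt0 e2).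
have v1 := eval_gt0 e1; have v2 := eval_gt0 e2.
have ne1 : eval e1 != 1 
  by apply/eqP => e; move: c2; rewrite -[eval e2]mul1n -[X in X * _]e en; lia.
have ne2 : eval e2 != 1 
  by apply/eqP => e; move: c1; rewrite -[eval e1]muln1 -[X in _ * X]e en; lia.
by exists (eval e1), (eval e2); rewrite -en in ce *; split=> //; lia.
Qed.

(* [complexity (3 ^ j * n) - 3 * j] is a nonincreasing sequence of natural
   numbers, hence eventually constant. *)
Lemma exists_stable n : 0 < n -> exists2 j, 0 < j & stable (3 ^ j * n).
Proof.
move=> n0; pose c j := complexity (3 ^ j * n).
have c_ge j : 3 * j <= c j.
  rewrite -(@leq_exp2l 3) // (leq_trans _ (cube_le _)) //.
  by rewrite expnMn -expnM mulnC leq_pmulr // expn_gt0 n0.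
have ex : exists v, `[< exists2 j, 0 < j & c j - 3 * j = v >].
  by exists (c 1 - 3 * 1); apply/asboolP; exists 1.
have [v /asboolP[j j0 cj] minv] := ex_minnP ex; exists j => //.
split=> [|k _]; first by rewrite muln_gt0 expn_gt0.
have : v <= c (k + j) - 3 * (k + j).
  by apply: minv; apply/asboolP; exists (k + j) => //; rewrite addn_gt0 j0 orbT.
have := c_ge (k + j); have := c_ge j.
have : c (k + j) <= 3 * k + c j.
  by rewrite /c expnD -mulnA complexity_pow3M // muln_gt0 expn_gt0.
by rewrite mulnA -expnD -/(c _) -/(c j); lia.
Qed.

(** The complexity of 3 is at most 3, whereas stability of 1 would require 4. *)
Lemma stable_neq1 n : stable n -> n <> 1.
Proof.
move=> [_ /(_ 1 isT)] + n1; rewrite n1 complexity1 muln1 expn1.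
by have := complexity3_le; lia.
Qed.

End Complexity.

(** * Upper bound on the order type of the defects *)

Section DefectBounds.
Context {R : realType}.
Implicit Types (x y s t : R) (A B : set R).

Local Notation ltR := (fun x y : R => x < y).
Local Notation sumset A B := [set x + y | x in A & y in B].
Local Notation "A '.<' s" := (A `&` [set x | x < s]) (at level 40).

Let ltR_irr x : ~ x < x. Proof. by rewrite ltxx. Qed.

(** If x + y < a + b then x < a or y < b, so the segment below a + b lies in two sumsets, each with
    one summand cut down to a proper segment and hence covered by pieces of lower rank. This gives
    an induction on [p + q]. *)
Lemma small_segments_sumset p q A B :
  small_segments ltR p A -> small_segments ltR q B ->
  small_segments ltR (p + q) (sumset A B).
Proof.
move: {2}(p + q)%N (erefl (p + q)%N) => n.
elim: n p q A B => [|n IHn] p q A B npq sA sB t [a Aa [b Bb <-{t}]].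
  move: npq sA sB => /eqP; rewrite addn_eq0 => /andP[/eqP-> /eqP->] sA sB.
  move=> _ [[x Ax [y By <-]]] /= lt_xy.
  have [lt_xa|le_ax] := ltP x a; first by case: (sA a Aa x).
  by case: (sB b Bb y); split=> //=; lra.
have sAl : small ltR (p + q) (sumset (A .< a) B).
  case: p npq sA => [_|p npq] sA.
    by apply: small_empty => t [x /(sA a Aa)].
  have [e_n] : (p + q)%N.+1 = n.+1 by rewrite -npq addSn.
  rewrite addSn; have := sA a Aa; rewrite [X in X -> _]/=.
  elim=> [C sC|C D E ECD _ IHC _ IHD].
    by apply: small_segments_small; apply: IHn.
  apply: (smallU _ IHC IHD) => _ [x /ECD[Cx|Dx] [y By <-]].
    by left; exists x => //; exists y.
  by right; exists x => //; exists y.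
have sBl : small ltR (p + q) (sumset A (B .< b)).
  case: q npq sB {sAl} => [_|q npq] sB.
    by apply: small_empty => t [x _ [y /(sB b Bb)]].
  have [e_n] : (p + q)%N.+1 = n.+1 by rewrite -npq addnS.
  rewrite addnS; have := sB b Bb; rewrite [X in X -> _]/=.
  elim=> [C sC|C D E ECD _ IHC _ IHD].
    by apply: small_segments_small; apply: IHn.
  apply: (smallU _ IHC IHD) => _ [x Ax [y /ECD[Cy|Dy] <-]].
    by left; exists x => //; exists y.
  by right; exists x => //; exists y.
apply: (smallU _ sAl sBl) => _ [[x Ax [y By <-]]] /= lt_xy.
have [lt_xa|le_ax] := ltP x a.
  by left; exists x => //; exists y.
by right; exists x => //; exists y => //; split=> //=; lra.
Qed.

Lemma small_sumset p q A B : small ltR p.+1 A -> small ltR q.+1 B ->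
  small ltR (p + q).+1 (sumset A B).
Proof.
move=> sA sB; elim: sA => [C sC|C D E ECD _ IHC _ IHD]; last first.
  apply: (smallU _ IHC IHD) => _ [x /ECD[Cx|Dx] [y By <-]].
    by left; exists x => //; exists y.
  by right; exists x => //; exists y.
elim: sB => [D sD|D E F FDE _ IHD _ IHE].
  by apply: small_segments_small; apply: small_segments_sumset.
apply: (smallU _ IHD IHE) => _ [x Cx [y /FDE[Dy|Ey] <-]].
  by left; exists x => //; exists y.
by right; exists x => //; exists y.
Qed.

(** The cutoff [K] lets the upper bound for the defects be proved one rank at a time. *)
Definition small_below (K : nat) A : Prop :=
  forall k s, (k <= K)%N -> s < k%:R -> small ltR k (A .< s).

(* Cut the simplex [x + y < s] into strips [i h <= x < (i + 1) h]: on each of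
   them [x < u] and [y < v] with [u + v < k], so the exponents add up. *)
Lemma small_below_sumset K A B :
  (forall x, A x -> 0 <= x) -> (forall x, B x -> 0 <= x) ->
  small_below K A -> small_below K B -> small_below K (sumset A B).
Proof.
move=> A0 B0 sA sB k s le_kK lt_sk.
(* Half of the slack, so that [u i + v i = s + h] stays below [k]. *)
pose h := (k%:R - s) / 2; have h0 : 0 < h by rewrite /h; lra.
pose u (i : nat) := i.+1%:R * h; pose v (i : nat) := s - i%:R * h.
have uv i : u i + v i < k%:R by rewrite /u /v -natr1 /h; lra.
pose M := Num.Def.archi_bound (s / h).
apply: (@small_bigU _ _ _ M (fun i => sumset (A .< u i) (B .< v i))).
  move=> _ [[x Ax [y By <-]]] /= lt_xy.
  have x0 := A0 x Ax; have y0 := B0 y By.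
  have xh0 : 0 <= x / h by rewrite divr_ge0 // ltW.
  have /andP[le_i lt_i] := truncn_itv xh0.
  exists (Num.truncn (x / h)).
    rewrite -(ltr_nat R) (le_lt_trans le_i) // (@lt_trans _ _ (s / h)) //.
      by rewrite ltr_pM2r ?invr_gt0 //; lra.
    by apply: archi_boundP; rewrite divr_ge0 ?(ltW h0) //; lra.
  rewrite ler_pdivlMr // in le_i; rewrite ltr_pdivrMr // in lt_i.
  by exists x => //; exists y => //; split=> //=; rewrite /v; lra.
move=> i _; have [v0|v0] := leP (v i) 0.
  by apply: small_empty => t [x _ [y [/B0 y0 /= lt_yv] _]]; exfalso; lra.
have u0 : 0 <= u i by rewrite mulr_ge0 // ltW.
have /andP[pu up] := truncn_itv u0; have /andP[qv vq] := truncn_itv (ltW v0).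
move: (Num.truncn _) (Num.truncn _) pu up qv vq => q p pu up qv vq.
(* [p] and [q] are the integer parts of [u i] and [v i]; the summands have ranks [p.+1] and [q.+1],
   and their sumset has rank [(p + q).+1 <= k]. *)
have pqk : (p + q < k)%N.
  by rewrite -(ltr_nat R) natrD; have := uv i; lra.
apply: (small_leq pqk); apply: small_sumset.
  by apply: (sA p.+1 _ _ up); apply: leq_trans le_kK; lia.
by apply: (sB q.+1 _ _ vq); apply: leq_trans le_kK; lia.
Qed.

Definition clog x : R := 3 * (ln x / ln 3).

Let ln3_gt0 : 0 < ln 3 :> R. Proof. by apply: ln_gt0; lra. Qed.

Lemma clogM x y : 0 < x -> 0 < y -> clog (x * y) = clog x + clog y.
Proof. by move=> x0 y0; rewrite /clog lnM ?posrE //=; ring. Qed.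

Lemma clog_lt x y : 0 < x -> x < y -> clog x < clog y.
Proof.
move=> x0 xy; rewrite /clog ltr_pM2l ?ltr_pM2r ?invr_gt0 ?ltr0n //.
by rewrite ltr_ln ?posrE // (lt_trans x0).
Qed.

Lemma clog_le x y : 0 < x -> x <= y -> clog x <= clog y.
Proof.
by move=> x0; rewrite le_eqVlt => /predU1P[->//|/(clog_lt x0)/ltW].
Qed.

Lemma clog1 : clog 1 = 0.
Proof. by rewrite /clog ln1 mul0r mulr0. Qed.

Lemma clog_exp3 n : clog (3 ^+ n) = 3 * n%:R.
Proof.
by rewrite /clog lnXn // -[_ *+ n]mulr_natl mulfK // gt_eqF.
Qed.

Lemma clog_le_nat n m : (0 < n)%N -> (n ^ 3 <= 3 ^ m)%N -> clog n%:R <= m%:R.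
Proof.
move=> n0 nm; have n0R : 0 < n%:R :> R by rewrite ltr0n.
rewrite /clog mulrA ler_pdivrMr // !mulr_natl -!lnXn // -!natrX.
by rewrite ler_ln ?posrE ?ltr0n ?expn_gt0 ?n0 // ler_nat.
Qed.

Lemma clog1D_lt_eventually (b : nat) (e : R) : 0 < e ->
  exists N, forall n, (N < n)%N -> clog (1 + b%:R / n%:R) < e.
Proof.
move=> e0; pose c : R := 3 * b%:R / (ln 3 * e).
have c0 : 0 <= c by rewrite divr_ge0 ?mulr_ge0 // ltW.
exists (Num.Def.archi_bound c) => n lt_n.
have cn : c < n%:R.
  by apply: lt_trans (archi_boundP c0) _; rewrite ltr_nat.
have n0 : 0 < n%:R :> R by apply: le_lt_trans cn.
have le_ln : ln (1 + b%:R / n%:R) <= b%:R / n%:R :> R.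
  by apply: le_ln1Dx; rewrite (lt_le_trans (ltrN10 _)) // divr_ge0 // ltW.
rewrite /clog mulrA ltr_pdivrMr //.
apply: (@le_lt_trans _ _ (3 * (b%:R / n%:R))); first by rewrite ler_pM2l.
rewrite mulrA ltr_pdivrMr //.
by move: cn; rewrite /c ltr_pdivrMr ?mulr_gt0 //; lra.
Qed.

Local Notation defect := (defect R).

Lemma defectE n : defect n = (complexity n)%:R - clog n%:R.
Proof. by []. Qed.

Lemma defect_ge0 n : (0 < n)%N -> 0 <= defect n.
Proof. by move=> n0; rewrite defectE subr_ge0 clog_le_nat // cube_le. Qed.

Lemma defectM u v : (0 < u)%N -> (0 < v)%N ->
  complexity (u * v) = (complexity u + complexity v)%N ->
  defect (u * v) = defect u + defect v.
Proof.
by move=> u0 v0 cuv; rewrite !defectE cuv natrM clogM ?ltr0n // natrD; lra.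
Qed.

(** The defect of [a + b] when this sum is optimal, as a formula in [a] that can be studied for all
    [a]. *)
Definition defect_add (b a : nat) : R :=
  defect a + (complexity b)%:R - clog (1 + b%:R / a%:R).

Lemma defectD a b : (0 < a)%N -> complexity (a + b) = (complexity a + complexity b)%N ->
  defect (a + b) = defect_add b a.
Proof.
move=> a0 cab; have a0R : 0 < a%:R :> R by rewrite ltr0n.
rewrite /defect_add !defectE cab.
have -> : (a + b)%:R = a%:R * (1 + b%:R / a%:R) :> R.
  by rewrite natrD mulrDr mulr1 mulrCA divff ?mulr1 // gt_eqF.
rewrite clogM //; first by rewrite natrD; lra.
by rewrite ltr_pwDl // divr_ge0 // ltW.
Qed.

(* Below [defect_add b n0], either [defect n < defect n0] or [n] is bounded,
   since [defect_add b n] tends to [defect n + complexity b] from below. *)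
Lemma small_defect_add (b k : nat) A : (0 < b)%N -> small ltR k A ->
  small ltR k.+1 [set x | exists n, [/\ (0 < n)%N, A (defect n) & defect_add b n = x]].
Proof.
move=> b0; elim: k A => [A A0|k IHk A].
  by apply: small_empty => x [n [_ /A0]].
elim=> [{}A QA|B C {}A ABC _ IHB _ IHC]; last first.
  apply: (smallU _ IHB IHC) => x [n [n0 /ABC[]]]; first by left; exists n.
  by right; exists n.
apply: small_segments_small => _ [m [m0 Am <-]].
have m0R : 0 < m%:R :> R by rewrite ltr0n.
have e0 : 0 < clog (1 + b%:R / m%:R).
  by rewrite -clog1 clog_lt // ltrDl divr_gt0 // ltr0n.
have [N NP] := clog1D_lt_eventually b e0.
apply: (smallU _ (IHk _ (QA _ Am)) (small_image_nat ltR_irr k N.+1 (defect_add b))).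
move=> _ [[n [n0 An <-]]] /= lt_nm.
have [lt_n|le_m] := ltP (defect n) (defect m); first by left; exists n.
right; exists n => //; rewrite ltnS leqNgt; apply/negP => /NP.
by move: lt_nm; rewrite /defect_add; lra.
Qed.

Definition defects : set R := [set defect n | n in [set n | (0 < n)%N]].

Definition additive_defects : set R :=
  [set x | exists a b, [/\ (0 < b)%N, (b <= a)%N,
    complexity (a + b) = (complexity a + complexity b)%N & defect (a + b) = x]].

Lemma additive_defects_ge0 x : additive_defects x -> 0 <= x.
Proof. by move=> [a [b [b0 _ _ <-]]]; rewrite defect_ge0 // addn_gt0 b0 orbT. Qed.

Lemma small_below_additive_defects K :
  small_below K defects -> small_below K.+1 additive_defects.
Proof.
move=> sD [s _ s0|k s le_kK lt_sk].
  by apply: small_empty => x [/additive_defects_ge0 x0] /= lt_xs; exfalso; lra.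
rewrite ltnS in le_kK; rewrite -natr1 in lt_sk.
have clog2 : clog 2 <= 2 by apply: (@clog_le_nat 2 2).
(* As [b <= a], the logarithmic term is at most [clog 2 <= 2], so [complexity b < s + 2 < M] and [b]
   is at most 3 ^ M. *)
pose M := Num.Def.archi_bound (s + 2).
apply: (@small_bigU _ _ _ (3 ^ M).+1 (fun b => [set x | exists a,
   [/\ (0 < b)%N, (0 < a)%N, x < s & defect_add b a = x]])).
  move=> x [[a [b [b0 le_ba cab xE]]] /= lt_xs].
  have a0 : (0 < a)%N by apply: leq_trans le_ba.
  have a0R : 0 < a%:R :> R by rewrite ltr0n.
  move: (xE); rewrite defectD // => xE'; exists b; last by exists a.
  have clog_ba : clog (1 + b%:R / a%:R) <= 2.
    apply: le_trans clog2; apply: clog_le.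
      by rewrite ltr_pwDl // divr_ge0 // ltW.
    suff : b%:R / a%:R <= 1 :> R by lra.
    by rewrite ler_pdivrMr // mul1r ler_nat.
  have cb : (complexity b < M)%N.
    rewrite -(ltr_nat R); have da := defect_ge0 a0.
    have cb0 : 0 <= (complexity b)%:R :> R by [].
    have : (complexity b)%:R < s + 2 by move: xE'; rewrite /defect_add; lra.
    by move=> lt_cb; apply: (lt_trans lt_cb); apply: archi_boundP; lra.
  rewrite ltnS (@leq_trans (b ^ 3)) //.
    by rewrite -[X in (X <= _)%N]expn1 leq_pexp2l.
  by rewrite (leq_trans (cube_le b)) // leq_pexp2l // ltnW.
move=> b _; have [->|b0] := posnP b; first by apply: small_empty => x [? []].
(* Since [complexity b >= 1], a large [a] with [defect_add b a < s] has [defect a < s - 1 + e < k],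
   so the hypothesis at rank [k] applies; the other [a] contribute a finite set. *)
pose e := (k%:R + 1 - s) / 2; have e0 : 0 < e by rewrite /e; lra.
have [N NP] := clog1D_lt_eventually b e0.
have lt_sek : s - 1 + e < k%:R by rewrite /e; lra.
apply: (smallU _ (small_defect_add b0 (sD k _ le_kK lt_sek))
                 (small_image_nat ltR_irr k N.+1 (defect_add b))).
move=> _ [a [_ a0 /[swap] <- lt_s]].
have [/NP lt_e|] := ltnP N a; last by right; exists a.
left; exists a; split=> //; split=> /=; first by exists a.
have : 1 <= (complexity b)%:R :> R by rewrite ler1n complexity_gt0.
by move: lt_s; rewrite /defect_add; lra.
Qed.

End DefectBounds.

(** * Defects as bounded sums of atoms *)

Section DefectOrderType.
Context {R : realType}.
Implicit Types (x y s t : R) (A B : set R).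

Local Notation ltR := (fun x y : R => x < y).
Local Notation sumset A B := [set x + y | x in A & y in B].
Local Notation "A '.<' s" := (A `&` [set x | x < s]) (at level 40).
Local Notation defect := (defect R).
Local Notation defects := (@defects R).

(** The value 1 is the defect of the number 1; the value 0 pads sums to a prescribed length. *)
Definition atoms : set R := additive_defects `|` [set 0; 1].

Fixpoint iter_sumset r A : set R :=
  if r is r'.+1 then sumset A (iter_sumset r' A) else [set 0].

Lemma atoms_ge0 x : atoms x -> 0 <= x.
Proof. by case=> [/additive_defects_ge0//|[->|->]]. Qed.

Lemma iter_sumset_ge0 r A x :
  (forall y, A y -> 0 <= y) -> iter_sumset r A x -> 0 <= x.
Proof.
move=> A0; elim: r x => [x ->//|r IHr _ [y /A0 y0 [z /IHr z0 <-]]].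
exact: addr_ge0.
Qed.

Lemma small_below_set1 K x : 0 <= x -> small_below K [set x].
Proof.
move=> x0 [s _ s0|k s _ _].
  by apply: small_empty => y [-> /=] lt_xs; exfalso; lra.
apply: (@small_leq _ _ 1) => //; apply: small_segments_small.
by move=> t [-> _] y [[/= -> _]]; rewrite ltxx.
Qed.

Lemma small_belowU K A B : small_below K A -> small_below K B ->
  small_below K (A `|` B).
Proof.
move=> sA sB k s le_kK lt_sk; apply: (smallU _ (sA k s le_kK lt_sk) (sB k s le_kK lt_sk)).
by move=> x [[Ax|Bx] lt_xs]; [left|right].
Qed.

Lemma small_below_atoms K : small_below K defects -> small_below K.+1 atoms.
Proof.
move=> sD; apply: small_belowU; first exact: small_below_additive_defects.
by apply: small_belowU; apply: small_below_set1.
Qed.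

Lemma small_below_iter_sumset K r A : (forall x, A x -> 0 <= x) ->
  small_below K A -> small_below K (iter_sumset r A).
Proof.
move=> A0 sA; elim: r => [|r IHr]; first exact: small_below_set1.
by apply: small_below_sumset => // x; apply: iter_sumset_ge0.
Qed.

(** Split along optimal products, on which the defect is additive, until only 1 and optimal sums
    remain. A number of defect 0 gets the empty list, which keeps all terms positive. *)
Lemma defect_sum_atoms n : (0 < n)%N ->
  exists2 l : seq R, (forall x, x \in l -> atoms x /\ 0 < x)
    & defect n = \sum_(x <- l) x.
Proof.
elim/ltn_ind: n => n IHn n0.
have [dn|dn0] := eqVneq (defect n) 0; first by exists [::]; rewrite ?big_nil.
have dn_gt0 : 0 < defect n by rewrite lt_def dn0 defect_ge0.
have [n1|[a [b [b0 le_ba nab cab]]]|[u [v [u1 v1 nuv cuv]]]] := efficient_cases n0.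
- exists [:: defect n] => [x|]; last by rewrite big_seq1.
  rewrite inE => /eqP->; split=> //; right; right.
  by rewrite n1 defectE complexity1 clog1 subr0.
- exists [:: defect n] => [x|]; last by rewrite big_seq1.
  rewrite inE => /eqP->; split=> //; left; exists a, b.
  by rewrite -nab.
- have [|lu lu_atoms du] := IHn u _ (ltnW u1); first by rewrite nuv; nia.
  have [|lv lv_atoms dv] := IHn v _ (ltnW v1); first by rewrite nuv; nia.
  exists (lu ++ lv) => [x|].
    by rewrite mem_cat => /orP[/lu_atoms|/lv_atoms].
  by rewrite big_cat -du -dv nuv; apply: defectM; rewrite -?nuv // ltnW.
Qed.

(** Below 1/2 the set has rank 1, hence its positive part there has a least element; if that part is
    empty, 1/2 serves. *)
Lemma positive_lower_bound K A : small_below K.+1 A ->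
  exists2 rho, 0 < rho & forall x, A x -> 0 < x -> rho <= x.
Proof.
move=> sA; have half : 1 / 2 < 1%:R :> R by lra.
have s1 := sA 1%N _ (ltn0Sn _) half.
pose X := A .< (1 / 2) `&` [set x | 0 < x].
have [neX|noX] := pselect (X !=set0); last first.
  exists (1 / 2) => [|x Ax x0]; first by lra.
  by rewrite leNgt; apply/negP => lt_x; apply: noX; exists x.
have [|||x [[[Ax /= lt_x] /= x0] minx]] :=
    @small_segments_wf _ ltR _ (A .< (1 / 2)) _ X _ neX.
- by move=> x y z; apply: lt_trans.
- by move=> t _; exists 1%N; apply: small_sub s1 => x [].
- by move=> x [].
exists x => // y Ay y0; rewrite leNgt; apply/negP => lt_yx.
by apply: (minx y) => //; split=> //; split=> //=; apply: lt_trans lt_x.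
Qed.

Lemma small_below_defects K : small_below K defects.
Proof.
elim: K => [|K IHK].
  move=> k s; rewrite leqn0 => /eqP-> s0.
  by apply: small_empty => _ [[n n0 <-]] /=; have := defect_ge0 (R := R) n0; lra.
have sP := small_below_atoms IHK.
have [rho rho0 rhoP] := positive_lower_bound sP.
move=> k s le_kK lt_sk.
(* At most [s / rho] positive atoms can sum to a defect below [s]. The guard [0 <= s] is harmless,
   as no defect is negative. *)
have [r lt_r] : exists r : nat, 0 <= s -> s / rho < r%:R.
  exists (Num.Def.archi_bound (s / rho)) => s0.
  by apply: archi_boundP; rewrite divr_ge0 // ltW.
have := small_below_iter_sumset r atoms_ge0 sP.
move=> /(_ k s le_kK lt_sk); apply: small_sub.
move=> _ [[n n0 <-] /= lt_ns]; split=> //.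
have [l l_atoms dn] := defect_sum_atoms n0.
have d0 := defect_ge0 (R := R) n0.
have size_l : (size l <= r)%N.
  have : rho *+ size l <= defect n.
    rewrite dn; elim: l l_atoms {dn} => [|x l IHl] l_atoms; first by rewrite big_nil.
    rewrite big_cons mulrS lerD ?IHl // => [|y ly].
      by have [Ax x0] := l_atoms x (mem_head _ _); apply: rhoP.
    by apply: l_atoms; rewrite inE ly orbT.
  rewrite -mulr_natr => le_l; apply: ltnW; rewrite -(ltr_nat R).
  apply: (@lt_trans _ _ (s / rho)).
    by rewrite ltr_pdivlMr // mulrC; apply: le_lt_trans lt_ns.
  by apply: lt_r; lra.
rewrite dn; elim: {dn}l r size_l l_atoms {lt_r} => [|x l IHl] r size_l l_atoms.
  rewrite big_nil; elim: r {size_l} => // r IHr; exists 0; first by right; left.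
  by exists 0; rewrite ?addr0.
case: r size_l => // r; rewrite ltnS => size_l.
rewrite big_cons; exists x; first by have [] := l_atoms x (mem_head _ _).
exists (\sum_(y <- l) y) => //; apply: IHl => // y ly.
by apply: l_atoms; rewrite inE ly orbT.
Qed.

Lemma small_segments_defects_lt k : small_segments ltR k (defects .< k%:R).
Proof.
move=> s [_ /= lt_sk]; apply: small_sub (small_below_defects (leqnn k) lt_sk).
by move=> x [[]].
Qed.

End DefectOrderType.

(** * Lower bound *)

Section LowerBound.
Context {R : realType}.
Implicit Types (x y s t : R) (f g : nat -> nat) (k i a : nat).

Local Notation ltR := (fun x y : R => x < y).
Local Notation flt := (@omega_pow_lt _ nat).
Local Notation "A '.<' s" := (A `&` [set x | x < s]) (at level 40).
Local Notation defect := (defect R).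
Local Notation defects := (@defects R).

(* In base 3, [digit_sum k f u] is [u] followed by [k] further digits 1, each
   preceded by a run of zeros: [f k.-1] zeros before the first, ..., [f 0]
   before the last. *)
Fixpoint digit_sum k f (u : nat) : nat :=
  if k is k'.+1 then digit_sum k' f (3 ^ (f k').+1 * u + 1) else u.

Fixpoint digit_count k f : nat :=
  if k is k'.+1 then digit_count k' f + (f k').+1 else 0.

(** The digits appended by [digit_sum], placed behind the ternary point. *)
Fixpoint ternary k f : R :=
  if k is k'.+1 then (1 + ternary k' f) / 3 ^+ (f k').+1 else 0.

Let exp3_gt0 n : 0 < 3 ^+ n :> R. Proof. exact: exprn_gt0. Qed.

Lemma digit_sumE k f u :
  (digit_sum k f u)%:R = 3 ^+ digit_count k f * (u%:R + ternary k f).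
Proof.
elim: k u => [|k IHk] u /=; first by rewrite mul1r addr0.
rewrite IHk natrD natrM natrX exprD -mulrA; congr (_ * _).
by rewrite mulrDr mulrCA divff ?mulr1 ?gt_eqF // addrA.
Qed.

Lemma digit_sum_complexity k f u : (0 < u)%N ->
  (0 < digit_sum k f u)%N /\
  (complexity (digit_sum k f u) <= complexity u + 3 * digit_count k f + k)%N.
Proof.
elim: k u => [|k IHk] u u0 /=; first by split=> //; lia.
have u'0 : (0 < 3 ^ (f k).+1 * u)%N by rewrite muln_gt0 expn_gt0.
have [|-> le_c] := IHk (3 ^ (f k).+1 * u + 1)%N; first by rewrite addn1.
have := complexityD u'0 (ltn0Sn 0); have := complexity_pow3M (f k).+1 u0.
by rewrite complexity1; split=> //; lia.
Qed.

Lemma ternary_ge0 k f : 0 <= ternary k f.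
Proof. by elim: k => //= k IHk; rewrite divr_ge0 ?addr_ge0 // ltW. Qed.

(** The bound is 0.111... in base 3, where no zeros separate the digits 1. *)
Lemma ternary_lt k f : ternary k f < 1 / 2.
Proof.
elim: k => [|k IHk] /=; first by lra.
rewrite ltr_pdivrMr // exprS.
have : 1 <= 3 ^+ f k :> R by rewrite exprn_ege1 // ler1n.
lra.
Qed.

Lemma ternary_gt0 k f : (0 < k)%N -> 0 < ternary k f.
Proof. by case: k => //= k _; rewrite divr_gt0 // ltr_pwDl // ternary_ge0. Qed.

(** The largest index carries the leading run of zeros, and a longer run makes the fraction
    smaller. *)
Lemma ternary_decreasing k f g : (forall i, (k <= i)%N -> f i = g i) ->
  flt f g -> ternary k g < ternary k f.
Proof.
elim: k => [fg [i []]|k IHk fg lt_fg /=]; first by rewrite fg ?ltnn.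
have [lt_k|gt_k|ek] := ltngtP (f k) (g k).
- apply: (@lt_le_trans _ _ (1 / 3 ^+ (f k).+1)); last first.
    by rewrite ler_pM2r ?invr_gt0 // lerDl ternary_ge0.
  rewrite ltr_pdivrMr // mulrAC ltr_pdivlMr // mul1r.
  apply: (@lt_le_trans _ _ (3 * 3 ^+ (f k).+1)).
    by rewrite ltr_pM2r //; have := ternary_lt k g; lra.
  by rewrite -exprS ler_weXn2l // ler1n.
- case: lt_fg => i [fgi fgj]; have [lt_ik|lt_ki|eik] := ltngtP i k.
  + by rewrite fgj ?ltnn // in gt_k.
  + by rewrite fg ?ltnn // in fgi.
  + by rewrite -eik ltnNge ltnW in gt_k.
- rewrite ek ltr_pM2r ?invr_gt0 // ltrD2l; apply: IHk => // i.
  by rewrite leq_eqVlt => /predU1P[<-//|]; apply: fg.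
Qed.

(** An integral defect makes n ^ 3, hence n, a power of 3, whose complexity is at most 3 times the
    exponent; so the defect is 0. Thus the closed interval up to a positive [k] contains no more
    stable defects than the half-open one. *)
Lemma stable_defect_nat n k : stable n -> defect n = k%:R -> k = 0%N.
Proof.
move=> st_n dn; have n0 := st_n.1; have n1 := stable_neq1 st_n.
have n0R : 0 < n%:R :> R by rewrite ltr0n.
have ln3 : 0 < ln 3 :> R by apply: ln_gt0; lra.
have clog_n : clog n%:R = (complexity n)%:R - k%:R :> R.
  by move: dn; rewrite defectE; lra.
have le_kc : (k <= complexity n)%N.
  by rewrite -(ler_nat R) -subr_ge0 -clog_n -clog1 clog_le // ler1n.
have cube : (n ^ 3 = 3 ^ (complexity n - k))%N.
  apply/eqP; rewrite -(eqr_nat R) !natrX; apply/eqP.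
  apply: ln_inj; rewrite ?posrE ?exprn_gt0 //.
  rewrite !lnXn // -[LHS]mulr_natl -[RHS]mulr_natl natrB // -clog_n /clog.
  by rewrite mulrA divfK // gt_eqF.
have /(dvdn_pfactor _ _ (isT : prime 3))[e _ ne] : (n %| 3 ^ (complexity n - k))%N.
  by rewrite -cube dvdn_exp.
case: e ne => [//|e] ne; move: cube; rewrite {1}ne -expnM => /eqP.
rewrite eqn_exp2l // => /eqP e3.
have := complexity_pow3M e (isT : (0 < 3)%N).
by rewrite mulnC -expnS -ne; have := complexity3_le; lia.
Qed.

Lemma Dmod_st_defects a : Dmod_st R a `<=` defects.
Proof. by move=> _ [_ [n [n0 _] <-]]; exists n. Qed.

Lemma small_segments_Dmod_st a k :
  small_segments ltR k (Dmod_st R a `&` `[0, k%:R]).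
Proof.
move=> s [Ds]; rewrite /= in_itv /= => /andP[_]; rewrite le_eqVlt => /predU1P[sk|lt_sk].
  case: Ds => _ [n st_n dn]; rewrite sk in dn *.
  rewrite (stable_defect_nat st_n dn).
  by move=> x [[_ /=]]; rewrite in_itv /= => /andP[x0 _]; rewrite ltNge x0.
apply: small_sub (small_below_defects (leqnn k) lt_sk).
by move=> x [[/Dmod_st_defects]].
Qed.

(* For [z := - clog (1 + ternary k f / 3)], some stable number has defect
   [i + z] with [i <= k]; the values [i < k] only account for a small set of
   [f]'s. *)
Lemma not_small_Dmod_st a k : k = a %[mod 3] ->
  ~ small ltR k (Dmod_st R a `&` `[0, k%:R]).
Proof.
move=> ka sS; apply: (@not_small_supported_below k).
pose h i f : R := i%:R - clog (1 + ternary k f / 3).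
have pos f : 0 < 1 + ternary k f / 3 by have := ternary_ge0 k f; lra.
(* For [i = k] the target is the set under study; for [i < k] it is all defects below [i], which
   have rank [i.+1 <= k]. *)
pose B i : set R := if i == k then Dmod_st R a `&` `[0, k%:R] else defects .< i%:R.
apply: (@small_bigU _ _ _ k.+1 (fun i => supported_below k `&` h i @^-1` B i)).
  move=> f Wf.
  (* The starting value 3 supplies the leading digits 10. *)
  have [N0 cN] := digit_sum_complexity k f (isT : (0 < 3)%N).
  have [j j0 st] := exists_stable N0; set M := (3 ^ j * _)%N in st.
  have cM : (complexity M <= 3 * (j + digit_count k f).+1 + k)%N.
    have := complexity_pow3M j N0; rewrite -/M.
    by move: cN complexity3_le; lia.
  have dM : defect M =
      (complexity M)%:R - (3 * (j + digit_count k f).+1)%:R - clog (1 + ternary k f / 3).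
    have -> : defect M = (complexity M)%:R - clog M%:R by [].
    have -> : M%:R = 3 ^+ (j + digit_count k f).+1 * (1 + ternary k f / 3) :> R.
      rewrite natrM natrX digit_sumE mulrA -exprD exprSr -mulrA; congr (_ * _); lra.
    by rewrite clogM // clog_exp3 natrM; lra.
  have dM0 := defect_ge0 (R := R) st.1.
  have clog0 : 0 <= clog (1 + ternary k f / 3).
    by rewrite -clog1 clog_le //; have := ternary_ge0 k f; lra.
  (* Nonnegativity of the defect and of the logarithm makes the subtraction defining [i] exact. *)
  have le_cM : (3 * (j + digit_count k f).+1 <= complexity M)%N.
    by rewrite -(ler_nat R); lra.
  rewrite -natrB // in dM; set i := (_ - _)%N in dM.
  have le_ik : (i <= k)%N by rewrite /i; lia.
  exists i => //; split=> //; rewrite /= /B.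
  have -> : h i f = defect M by [].
  have [ik|nik] := eqVneq i k.
    split; first split.
    - exists M => //; split; [exact: st.1|exact: stable_neq1|].
      (* [complexity M] exceeds [i = k] by a multiple of 3, which gives the class of [a]. *)
      by rewrite -(subnKC le_cM) -/i ik mulnC modnMDl.
    - by exists M.
    - by rewrite /= in_itv /= dM0 /= dM ik; lra.
  split; first by exists M => //; exact: st.1.
  have lt_ik : (i < k)%N by rewrite ltn_neqAle nik.
  rewrite /= dM ltrBlDr ltrDl -clog1 clog_lt //.
  have := ternary_gt0 f (leq_ltn_trans (leq0n _) lt_ik); lra.
move=> i; rewrite ltnS => le_ik.
apply: (small_embedding (ltU := ltR) (h := h i) (B := B i)) =>
  [f []//|f g [Wf _] [Wg _] lt_fg|].
  rewrite /h /= ltrD2l ltrN2 clog_lt // ltrD2l ltr_pM2r ?invr_gt0 ?ltr0n //.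
  by apply: ternary_decreasing => // l le_kl; rewrite Wf ?Wg.
rewrite /B; case: eqVneq => // nik; have lt_ik : (i < k)%N by rewrite ltn_neqAle nik.
exact/(small_leq lt_ik)/small_segments_small/small_segments_defects_lt.
Qed.

Lemma well_ordered_defects : well_ordered_by ltR defects.
Proof.
split; first by move=> x; rewrite ltxx.
  by move=> x y _ _; case: (ltgtP x y); [constructor 1|constructor 3|constructor 2].
apply: small_segments_wf => [x y z|t [n n0 dn]]; first exact: lt_trans.
have lt_t := archi_boundP (defect_ge0 (R := R) n0); rewrite dn in lt_t.
by exists (Num.Def.archi_bound t); apply: small_below_defects lt_t.
Qed.

End LowerBound.

Theorem theorem7p3 (R : realType) (a : nat) (ha : (a < 3)%N) :
  [/\ wo_chain (<=%R : rel R) (mem (Dmod_st R a)),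
      has_order_type_omega_pow (Dmod_st R a) nat
    & forall k : nat, k = a %[mod 3] ->
        has_order_type_omega_pow (Dmod_st R a `&` `[0, k%:R]) 'I_k].
Proof.
have woD := well_ordered_by_sub (@Dmod_st_defects R a) well_ordered_defects.
split.
- apply: antisymmetric_wo_chain; first by move=> x y _ _; apply: le_anti.
  move=> A AD [x0 Ax0]; have [_ _ wf] := woD.
  have [||z [Az minz]] := wf [set x | x \in A].
  + by move=> x /AD; rewrite inE.
  + by exists x0.
  by exists z; split=> // y Ay; rewrite leNgt; apply/negP/minz.
- apply: (order_isomorphic_of_no_embedding (fun=> 0%N) 0
    well_ordered_omega_pow_nat woD) => [h y Dy hsub hlt|h f Wf hsub hlt].
    (* An embedding of omega ^ omega below [y < k] would make omega ^ k small of rank k. *)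
    have [k lt_yk] : exists k : nat, y < k%:R.
      have [n n0 <-] := Dmod_st_defects Dy.
      by eexists; apply: archi_boundP (defect_ge0 n0).
    apply: (@not_small_supported_below k).
    have sub : supported_below k `<=` @omega_pow _ nat.
      by move=> g gk; apply/omega_pow_natP; exists k.
    apply: (small_embedding (h := h) _ _ (small_below_defects (leqnn k) lt_yk)).
      by move=> g /sub /hsub[/= /Dmod_st_defects].
    by move=> g g' /sub Wg /sub Wg'; apply: hlt.
  (* [l * 3 + a] is an exponent at least [l] in the class of [a], so the lower bound applies to it
     and [f] lies in that power of omega. *)
  have [l fl] := (omega_pow_natP f).1 Wf.
  have fk := supported_below_leq (leq_trans (leq_pmulr l (isT : (0 < 3)%N))
               (leq_addr a _)) fl.
  apply: (@not_small_Dmod_st R a (l * 3 + a)); first by rewrite modnMDl.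
  apply: (small_embedding (h := h) _ _ (small_segments_supported_below fk)).
    move=> x [/hsub[/= _ lt_hf] _]; split=> // i le_i.
    by rewrite (supported_below_lt fk lt_hf) ?fk.
  by move=> x y [Dx _] [Dy _]; apply: hlt.
- move=> k ka; apply: omega_pow_ord_isomorphic.
  apply: (order_isomorphic_of_no_embedding (fun=> 0%N) 0
    (well_ordered_supported_below k)
    (well_ordered_by_sub _ woD)) => [x []//|h y Dy hsub hlt|h f Wf hsub hlt].
    apply: (@not_small_supported_below k).
    exact: (small_embedding hsub hlt (small_segments_Dmod_st Dy)).
  apply: (not_small_Dmod_st ka).
  exact: (small_embedding hsub hlt (small_segments_supported_below Wf)).
Qed.
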